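(* Let $n\ge 2$, let $m\ge 2$ be even with $m/2$ odd, and let $x_1,x_2,\dots,x_m$ be distinct elements of $\{1,\dots,n\}$, so that $(x_1\,x_2),(x_3\,x_4),\dots,(x_{m-1}\,x_m)$ are pairwise disjoint transpositions. Then the subgroup $H=\langle (x_1\,x_2)(x_3\,x_4)\cdots(x_{m-1}\,x_m)\rangle$ of $S_n$ is a perfect code of $S_n$.
   Context: For a group $G$ and a subset $S\subseteq G\setminus\{1_G\}$ with $S=S^{-1}$, the Cayley graph $\mathrm{Cay}(G,S)$ has vertex set $G$, with $g$ and $h$ adjacent iff $hg^{-1}\in S$. A perfect code in a graph $\Gamma$ is a subset $C$ of the vertex set such that no two vertices of $C$ are adjacent and every vertex outside $C$ is adjacent to exactly one vertex of $C$. A subgroup $H$ of a group $G$ is a perfect code of $G$ if there exists a Cayley graph $\mathrm{Cay}(G,S)$ of $G$ in which $H$ is a perfect code. *)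

(* Defs.v *)
From mathcomp Require Import all_boot all_fingroup.

Set Implicit Arguments.
Unset Strict Implicit.
Unset Printing Implicit Defensive.

Local Open Scope group_scope.

(* A graph on [T] is given by its adjacency relation [e]. *)
Definition perfect_code (T : finType) (e : rel T) (C : {set T}) : Prop :=
  (forall u v, u \in C -> v \in C -> ~~ e u v) /\
  (forall v, v \notin C -> exists! u, u \in C /\ e v u).

Definition connection_set (gT : finGroupType) (S : {set gT}) : Prop :=
  1 \notin S /\ S^-1 = S.

Definition cayley_graph (gT : finGroupType) (S : {set gT}) : rel gT :=
  fun g h => h * g^-1 \in S.

(* The ambient group is the whole type [gT]. *)
Definition subgroup_perfect_code (gT : finGroupType) (H : {group gT}) : Prop :=
  exists S : {set gT}, connection_set S /\ perfect_code (cayley_graph S) H.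

(* The points are indexed from 0, so the factors of the product are the
   [tperm (x i) (x (i + 1))] for [i] even; [ordS] is the cyclic successor in
   ['I_m], which for [m] even does not wrap around at an even index. *)
Definition paired_transpositions (n m : nat) (x : 'I_m -> 'I_n) : 'S_n :=
  \prod_(i < m | ~~ odd i) tperm (x i) (x (ordS i)).

(* Main.v *)
Require Import Defs.
From mathcomp Require Import all_boot all_fingroup.
From mathcomp Require Import cyclic.

(** Let H = {1, t} with t an involution. The neighbours of v in H correspond to
    the elements of S among v^-1 and t v^-1, so H is a perfect code for an
    inverse-closed S iff S misses H and contains exactly one of g and t g for
    every g outside H. Inversion commutes with g |-> t g up to conjugation by t,
    so both maps act on the classes {g, g^-1, g^t, (g^-1)^t}: inversion fixes
    each class, while left multiplication by t exchanges the class of g with that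
    of t g. These two classes differ as soon as t is not a square, and then S can
    be chosen as the union of one class from each exchanged pair outside H. A
    product of an odd number of transpositions is odd, hence not a square. *)

Set Implicit Arguments.
Unset Strict Implicit.
Unset Printing Implicit Defensive.

Local Open Scope group_scope.

Section InvolutionCode.

Variables (gT : finGroupType) (t : gT).
Hypothesis tt1 : t * t = 1.

Definition inv_conj_class (g : gT) : {set gT} :=
  [set g; g^-1; g ^ t; g^-1 ^ t].

Lemma involution_inv : t^-1 = t.
Proof. by rewrite -[RHS](mulKg t) tt1 mulg1. Qed.

Lemma involution_mulK : involutive (fun g => t * g).
Proof. by move=> g; rewrite mulgA tt1 mul1g. Qed.

Lemma inv_conj_classV g : inv_conj_class g^-1 = inv_conj_class g.
Proof.
apply/setP=> h; rewrite !inE invgK.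
by do 4!case: (h == _).
Qed.

Lemma inv_conj_classJ g : inv_conj_class (g ^ t) = inv_conj_class g.
Proof.
apply/setP=> h; rewrite !inE -!conjVg -!conjgM tt1 !conjg1.
by do 4!case: (h == _).
Qed.

(** Since [t] is an involution, [((t * g)^-1) ^ t = t * g^-1]. *)
Lemma inv_conj_class_mulV g :
  inv_conj_class (t * g^-1) = inv_conj_class (t * g).
Proof.
rewrite -[RHS]inv_conj_classV -[RHS]inv_conj_classJ.
by rewrite invMg involution_inv conjgE involution_inv -!mulgA tt1 mulg1.
Qed.

Lemma inv_conj_class_mul_neq g :
  t != 1 -> (forall h : gT, h * h != t) ->
  inv_conj_class g != inv_conj_class (t * g).
Proof.
move=> t1 nsq; apply/eqP=> /setP/(_ g).
rewrite !inE eqxx /= !conjgE !invMg involution_inv -!mulgA tt1 mulg1.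
rewrite involution_mulK => /esym.
(* If [g] lies in the class of [t * g], then either [g = t * g] or [g = g * t], forcing [t = 1], or
   else [g = g^-1 * t] or [g = t * g^-1], making [t] the square of [g]. *)
rewrite -!orbA; case/or4P => /eqP e.
- by case/eqP: t1; apply: (mulIg g); rewrite mul1g -e.
- by case/eqP: (nsq g); rewrite {2}e mulKVg.
- by case/eqP: t1; apply: (mulgI g); rewrite mulg1 -e.
- by case/eqP: (nsq g); rewrite {1}e mulgKV.
Qed.

Lemma nonsquare_involution_perfect_code :
  t != 1 -> (forall h : gT, h * h != t) -> subgroup_perfect_code <[t]>%G.
Proof.
move=> t1 nsq.
(* Of two exchanged classes, the one of smaller rank in a fixed enumeration is chosen. *)
pose f g := enum_rank (inv_conj_class g) < enum_rank (inv_conj_class (t * g)).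
have fV g : f g^-1 = f g by rewrite /f inv_conj_classV inv_conj_class_mulV.
have ft g : f (t * g) = ~~ f g.
  rewrite /f involution_mulK -leqNgt ltn_neqAle andb_idl // => _.
  rewrite (inj_eq (@ord_inj _)) (inj_eq enum_rank_inj) eq_sym.
  exact: inv_conj_class_mul_neq.
have memH u : (u \in <[t]>) = (u == 1) || (u == t).
  have ->: <[t]> = [set 1; t] by exact/cycle2g/nt_prime_order.
  by rewrite !inE.
exists [set g | g \notin <[t]> & f g]; split; first split.
- by rewrite inE group1.
- by apply/setP=> g; rewrite !inE groupV fV.
split=> [u v Hu Hv|v nHv].
  by rewrite /cayley_graph inE groupM ?groupV.
have adj u : u \in <[t]> ->
    cayley_graph [set g | g \notin <[t]> & f g] v u = f (u * v^-1).
  by move=> Hu; rewrite /cayley_graph inE groupMl ?groupV ?nHv.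
(* Adjacency of [v] to 1 is [f v^-1 = f v], and to [t] it is [f (t * v^-1) = ~~ f v]. *)
have Ht := cycle_id t; exists (if f v then 1 else t); split.
  by case: ifP => fv; rewrite adj ?group1 ?mul1g ?ft ?fV ?fv.
move=> u [Hu]; rewrite adj //; move: Hu; rewrite /= memH.
by case/orP=> /eqP->; rewrite ?mul1g ?ft fV; case: (f v).
Qed.

End InvolutionCode.

Lemma prod_commute_involutions (gT : finGroupType) (I : Type) (r : seq I)
    (P : pred I) (F : I -> gT) :
  (forall i, P i -> F i * F i = 1) ->
  (forall i j, P i -> P j -> commute (F i) (F j)) ->
  (\prod_(i <- r | P i) F i) * (\prod_(i <- r | P i) F i) = 1.
Proof.
move=> FF1 cF; elim: r => [|i r IHr]; first by rewrite big_nil mulg1.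
rewrite big_cons; case: ifP => // Pi.
set p := \prod_(j <- r | P j) F j in IHr *.
have cp : commute (F i) p.
  by apply: big_ind => [||j Pj]; [apply: commute1 | apply: commuteM | apply: cF].
by rewrite {2}cp -mulgA (mulgA p) IHr mul1g FF1.
Qed.

Lemma odd_perm_prod (T : finType) (I : Type) (r : seq I) (P : pred I)
    (F : I -> {perm T}) :
  odd_perm (\prod_(i <- r | P i) F i) =
  \big[addb/false]_(i <- r | P i) odd_perm (F i).
Proof. exact: (big_morph _ (@odd_permM T) (odd_perm1 T)). Qed.

(** For odd [m] the last index is even, hence the rounding up. *)
Lemma sum1_even_ord m : \sum_(i < m | ~~ odd i) 1 = uphalf m.
Proof.
rewrite -(big_mkord (fun i => ~~ odd i) (fun=> 1%N)).
elim: m => [|m IHm]; first by rewrite big_nil.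
rewrite big_mkcond big_nat_recr //= -big_mkcond IHm uphalf_half.
by rewrite addnC; case: (odd m).
Qed.

Section PairedTranspositions.

Variables (n m : nat) (x : 'I_m -> 'I_n).
Hypotheses (evenm : ~~ odd m) (xI : injective x).

(** Only the index [m - 1] wraps around, and it is odd. *)
Lemma val_ordS_even (i : 'I_m) : ~~ odd i -> ordS i = i.+1 :> nat.
Proof.
move=> ei /=; rewrite modn_small // ltn_neqAle ltn_ord andbT.
by apply: contraNneq evenm => <-; rewrite /= ei.
Qed.

Lemma odd_paired_transpositions :
  odd_perm (paired_transpositions x) = odd m./2.
Proof.
rewrite /paired_transpositions odd_perm_prod.
(* With each parity written as [odd 1], the sum mod 2 becomes the parity of the number of
   factors. *)
rewrite (eq_bigr (fun=> odd 1)) => [|i ei].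
  rewrite -(big_morph odd oddD (erefl : odd 0 = false)).
  by rewrite sum1_even_ord uphalf_half (negbTE evenm).
rewrite odd_tperm (inj_eq xI) -(inj_eq (@ord_inj _)).
by rewrite val_ordS_even // neq_ltn ltnSn.
Qed.

Lemma paired_transpositions_mul_self :
  paired_transpositions x * paired_transpositions x = 1.
Proof.
apply: prod_commute_involutions => [i _|i j ei ej]; first exact: tperm2.
have [->|ij] := eqVneq i j; first exact: commute_refl.
(* The successor of an even index is odd. *)
have neqS (k l : 'I_m) : ~~ odd k -> ~~ odd l -> k != ordS l.
  move=> ek el; apply: contraNneq ek => ->.
  by rewrite val_ordS_even //= el.
have SS : ordS i != ordS j by rewrite (inj_eq (can_inj (@ordSK m))).
(* Conjugating one transposition by the other fixes it, as the four points are distinct. *)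
apply/esym/commgP/conjg_fixP; rewrite tpermJ !tpermD //.
all: by rewrite (inj_eq xI) // ?neqS // 1?eq_sym ?neqS // eq_sym.
Qed.

End PairedTranspositions.

Theorem theorem2 (n m : nat) (x : 'I_m -> 'I_n) :
  2 <= n -> 2 <= m -> ~~ odd m -> odd (m./2) -> injective x ->
  subgroup_perfect_code <[paired_transpositions x]>%G.
Proof.
move=> _ _ evenm oddh xI.
have oddt := odd_paired_transpositions evenm xI; rewrite oddh in oddt.
apply: nonsquare_involution_perfect_code.
- exact: paired_transpositions_mul_self.
- by apply: contraTneq oddt => ->; rewrite odd_perm1.
- by move=> h; apply: contraTneq oddt => <-; rewrite odd_permM addbb.
Qed.
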